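(* Let $n\in\mathbb{Z}$ and let $A$ be an $\mathrm{SU}(3)$-invariant connection on the $S^1$-bundle $E_n\to X^*$ in temporal gauge, where $X^*=T^*\mathbb{CP}^2\setminus\mathbb{CP}^2$ carries the Calabi hyperkähler structure, so that $A=A_{n,0}+(p_0(r)\kappa+p_1(r)\nu_1+p_2(r)\nu_2)\otimes T$ for some functions $p_0,p_1,p_2:(1,\infty)\to\mathbb{R}$. Then: (a) $A$ is an $I$-$\mathrm{Spin}(7)$-instanton if and only if $$p_0(r)=-\frac{n}{r^2}\Big(1+\frac{C_0}{r^4-1}\Big),\quad p_1(r)=C_1(r^4-1)^{1/2},\quad p_2(r)=C_2(r^4-1)^{-3/2}$$ for some constants $C_0,C_1,C_2\in\mathbb{R}$. (b) $A$ is a $J$-$\mathrm{Spin}(7)$-instanton if and only if $$p_0(r)=-\frac{n}{r^2}+C_0\frac{1-r^4}{r^2},\quad p_1(r)=C_1(r^4-1)^{-3/2},\quad p_2(r)=C_2(r^4-1)^{-3/2}$$ for some constants $C_0,C_1,C_2\in\mathbb{R}$. (c) $A$ is a $K$-$\mathrm{Spin}(7)$-instanton if and only if $$p_0(r)=-\frac{n}{r^2}\Big(1+\frac{C_0}{r^4-1}\Big),\quad p_1(r)=C_1(r^4-1)^{-3/2},\quad p_2(r)=C_2(r^4-1)^{1/2}$$ for some constants $C_0,C_1,C_2\in\mathbb{R}$.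
   Context: **Calabi structure.** $\mathrm{SU}(3)$ acts on $X=T^*\mathbb{CP}^2$ in the standard way; $X^*$ is the complement of the zero section. Let $K_0=\{\mathrm{diag}(e^{i\theta},e^{i\theta},e^{-2i\theta})\}\cong\mathrm{U}(1)$ and $N_{1,1}=\mathrm{SU}(3)/K_0$. Write the left-invariant Maurer–Cartan form of $\mathrm{SU}(3)$ as $$\eta=\begin{bmatrix} i(\zeta+\kappa)&\nu&\sigma\\-\overline\nu&i(\zeta-\kappa)&\mu\\-\overline\sigma&-\overline\mu&-2i\zeta\end{bmatrix},\quad \nu=\nu_1+i\nu_2,\ \sigma=\sigma_1+i\sigma_2,\ \mu=\mu_1+i\mu_2,$$ which defines real left-invariant $1$-forms $\zeta,\kappa,\nu_j,\sigma_j,\mu_j$. The principal locus $X^*$ is identified $\mathrm{SU}(3)$-equivariantly with $(1,\infty)\times N_{1,1}$, with coordinate $r\in(1,\infty)$; forms on $X^*$ are identified with their pullbacks to $(1,\infty)\times\mathrm{SU}(3)$. Put $a=\sqrt{(r^2-1)/2}$, $b=\sqrt{(r^2+1)/2}$, $c=r$, $f=\frac1r\sqrt{r^4-1}$, $dt=\sqrt{r^4/(r^4-1)}\,dr$, and $e^0=dt$, $e^1=a\sigma_1$, $e^2=a\sigma_2$, $e^3=b\mu_1$, $e^4=b\mu_2$, $e^5=c\nu_1$, $e^6=c\nu_2$, $e^7=f\kappa$. The Calabi metric is $g=\sum_{j=0}^7(e^j)^2$, with orientation $e^{0}\wedge e^1\wedge\cdots\wedge e^7$ and Kähler forms ($e^{ij}=e^i\wedge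 e^j$) $$\omega_I=-e^{07}+e^{56}+e^{12}-e^{34},\quad \omega_J=-e^{06}-e^{57}-e^{23}+e^{14},\quad \omega_K=e^{05}-e^{67}+e^{24}+e^{13}.$$ Set $\Phi_I=\frac12(\omega_I^2+\omega_J^2-\omega_K^2)$, $\Phi_J=\frac12(-\omega_I^2+\omega_J^2+\omega_K^2)$, $\Phi_K=\frac12(\omega_I^2-\omega_J^2+\omega_K^2)$. A connection $A$ with curvature $F_A$ is an $L$-$\mathrm{Spin}(7)$-instanton ($L\in\{I,J,K\}$) if $\ast F_A=-\Phi_L\wedge F_A$. **Bundles and connections.** For $n\in\mathbb{Z}$ let $P_n=(\mathrm{SU}(3)\times S^1)/\!\sim$ with $(h,s)\sim(hz,sz^n)$ for $z\in\mathrm{U}(1)\cong K_0$ (via $e^{i\theta}\mapsto\mathrm{diag}(e^{i\theta},e^{i\theta},e^{-2i\theta})$), a principal $S^1$-bundle over $N_{1,1}$ with left $\mathrm{SU}(3)$-action and right $S^1$-action $[h,s]\cdot s'=[h,s'^{-1}s]$; $E_n=(1,\infty)\times P_n\to X^*$ is its pullback to $X^*$. $T$ is the standard basis vector of $\mathrm{Lie}(S^1)$. A connection on $E_n$ is in temporal gauge if its connection form has no $dr$ component; it is identified with its pullback to $(1,\infty)\times\mathrm{SU}(3)$ under $(r,h)\mapsto(r,[h,1])$. The canonical connection is $A_{n,0}=n\zeta\otimes T$. $\mathrm{SU}(3)$-invariant connections in temporal gauge are exactly those of the form displayed in the claim.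
   Formalization: In (a) and (c), for n = 0 the printed p_0 collapses to 0 and ''only if'' fails (p_0 = 1/(r^2(r^4-1)), p_1 = p_2 = 0 is an instanton); for n = 0 the family is taken to be p_0 = C_0/(r^2(r^4-1)). The functions p_0, p_1, p_2 are assumed differentiable. *)

(* Defs.v *)
From HB Require Import structures.
From mathcomp Require Import all_boot all_order all_algebra spectral complex.
From mathcomp Require Import all_classical all_reals all_analysis.

Set Implicit Arguments.
Unset Strict Implicit.
Unset Printing Implicit Defensive.

Import Order.TTheory GRing.Theory Num.Theory.
Local Open Scope ring_scope.
Local Open Scope sesquilinear_scope.

(* Differential forms on M = (1, +oo) x SU(3), a submanifold of the real vector
   space R x M_3(C).  A 1-form on M is given by an ambient 1-form on R x M_3(C);
   since d commutes with restriction to M, the values of its ambient exterior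
   derivative on vectors tangent to M do not depend on the ambient extension. *)
Section FormsOnM.
Variable R : realType.

Definition ambient : Type := (R * 'M[R[i]]_3)%type.

(* x + t u *)
Definition translate (x : ambient) (t : R) (u : ambient) : ambient :=
  (x.1 + t * u.1, x.2 + (Complex t 0) *: u.2).

Definition form1 : Type := ambient -> ambient -> R.

(* (dA)_x(u, v) = D_u(A(v)) - D_v(A(u)) for constant vector fields u, v *)
Definition dform (A : form1) (x u v : ambient) : R :=
  derive1 (fun t : R => A (translate x t u) v) 0 -
  derive1 (fun t : R => A (translate x t v) u) 0.

Definition SU3 (h : 'M[R[i]]_3) : Prop := h \is unitarymx /\ \det h = 1.

Definition su3 (X : 'M[R[i]]_3) : Prop := X ^t* = - X /\ \tr X = 0.

Definition inM (x : ambient) : Prop := 1 < x.1 /\ SU3 x.2.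

Definition tangent (x u : ambient) : Prop := su3 (x.2 ^t* *m u.2).

(* The Maurer-Cartan form h^-1 dh; on SU(3) the inverse is the adjoint. *)
Definition eta (x u : ambient) : 'M[R[i]]_3 := x.2 ^t* *m u.2.

Definition zeta : form1 := fun x u => - complex.Im (eta x u 2 2) / 2.
Definition kappa : form1 := fun x u => (complex.Im (eta x u 0 0) - complex.Im (eta x u 1 1)) / 2.
Definition nu1 : form1 := fun x u => complex.Re (eta x u 0 1).
Definition nu2 : form1 := fun x u => complex.Im (eta x u 0 1).
Definition sigma1 : form1 := fun x u => complex.Re (eta x u 0 2).
Definition sigma2 : form1 := fun x u => complex.Im (eta x u 0 2).
Definition mu1 : form1 := fun x u => complex.Re (eta x u 1 2).
Definition mu2 : form1 := fun x u => complex.Im (eta x u 1 2).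

(* The Calabi coframe e^0, ..., e^7, pulled back to M. *)
Definition coframe (j : nat) : form1 := fun x u =>
  let r := x.1 in
  let a := Num.sqrt ((r ^+ 2 - 1) / 2) in
  let b := Num.sqrt ((r ^+ 2 + 1) / 2) in
  let c := r in
  let f := r^-1 * Num.sqrt (r ^+ 4 - 1) in
  nth 0 [:: Num.sqrt (r ^+ 4 / (r ^+ 4 - 1)) * u.1;
            a * sigma1 x u; a * sigma2 x u;
            b * mu1 x u; b * mu2 x u;
            c * nu1 x u; c * nu2 x u;
            f * kappa x u] j.

End FormsOnM.

(* The exterior algebra of a cotangent space of X^*, in the basis e^S
   (S a set of indices, listed increasingly) built from the coframe.  The
   coframe is orthonormal and positively ordered by definition of the Calabi
   metric and of the orientation. *)
Section ExteriorAlgebra.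
Variable R : realType.

Definition ext : Type := {ffun {set 'I_8} -> R}.

(* e^A /\ e^B = wsign A B *: e^(A u B) for disjoint A and B *)
Definition wsign (A B : {set 'I_8}) : R :=
  (-1) ^+ #|[set p : 'I_8 * 'I_8 | [&& p.1 \in A, p.2 \in B & (p.2 < p.1)%N]]|.

Definition wedge (w w' : ext) : ext :=
  [ffun S : {set 'I_8} => \sum_(A : {set 'I_8} | A \subset S)
     wsign A (S :\: A) * (w A * w' (S :\: A))].

(* *e^S = wsign S S^c *: e^(S^c), so that e^S /\ *e^S = e^01234567 *)
Definition hodge (w : ext) : ext :=
  [ffun S : {set 'I_8} => wsign (~: S) S * w (~: S)].

Definition e1 (i : nat) : ext := [ffun S : {set 'I_8} => (S == [set inord i])%:R].
Definition e2 (i j : nat) : ext := wedge (e1 i) (e1 j).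

Definition omega_I : ext := - e2 0 7 + e2 5 6 + e2 1 2 - e2 3 4.
Definition omega_J : ext := - e2 0 6 - e2 5 7 - e2 2 3 + e2 1 4.
Definition omega_K : ext := e2 0 5 - e2 6 7 + e2 2 4 + e2 1 3.

Definition Phi_I : ext := 2^-1 *:
  (wedge omega_I omega_I + wedge omega_J omega_J - wedge omega_K omega_K : ext).
Definition Phi_J : ext := 2^-1 *:
  (- wedge omega_I omega_I + wedge omega_J omega_J + wedge omega_K omega_K : ext).
Definition Phi_K : ext := 2^-1 *:
  (wedge omega_I omega_I - wedge omega_J omega_J + wedge omega_K omega_K : ext).

End ExteriorAlgebra.

Section Instantons.
Variable R : realType.

(* The alternating form F on the tangent space of M at x is the pullback of
   the 2-covector w = \sum_(i < j) w_ij e^ij of X^*. *)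
Definition pullback2 (x : ambient R) (w : ext R) (F : ambient R -> ambient R -> R) : Prop :=
  (forall S : {set 'I_8}, #|S| != 2%N -> w S = 0) /\
  (forall u v, tangent x u -> tangent x v ->
     F u v = \sum_(i < 8) \sum_(j < 8 | (i < j)%N) w [set i; j] *
       (coframe i x u * coframe j x v - coframe j x u * coframe i x v)).

(* *F_A = - Phi /\ F_A; as S^1 is abelian, F_A = dA. *)
Definition spin7_instanton (Phi : ext R) (A : form1 R) : Prop :=
  forall x, inM x ->
    exists2 w : ext R, pullback2 x w (dform A x) & hodge w = - wedge Phi w.

Definition K0 (z : R[i]) : 'M[R[i]]_3 :=
  diag_mx (\row_(j < 3) if j == 2 then z ^- 2 else z).
Definition K0_gen : 'M[R[i]]_3 :=
  diag_mx (\row_(j < 3) if j == 2 then Complex 0 (-2) else Complex 0 1).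

(* Pullbacks to M, under (r, h) |-> (r, [h, 1]), of the connection forms on E_n
   (Lie(S^1) being identified with R through T).  Since
   [hz, 1] = [h, z^-n] = [h, 1].z^n for z in K_0, these are the 1-forms on M that
   are invariant under right translation by K_0 and send its generator to n. *)
Definition connection_on_E (n : int) (A : form1 R) : Prop :=
  [/\ forall x, inM x -> forall t u v, tangent x u -> tangent x v ->
        A x (translate v t u) = A x v + t * A x u,
      forall x, inM x -> A x (0, x.2 *m K0_gen) = n%:~R
    & forall x u z, inM x -> tangent x u -> `|z| = 1 ->
        A (x.1, x.2 *m K0 z) (u.1, u.2 *m K0 z) = A x u].

Definition SU3_invariant (A : form1 R) : Prop :=
  forall g x u, SU3 g -> inM x -> tangent x u ->
    A (x.1, g *m x.2) (u.1, g *m u.2) = A x u.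

Definition temporal_gauge (A : form1 R) : Prop :=
  forall x (s : R), inM x -> A x (s, 0) = 0.

Definition canonical_connection (n : int) : form1 R := fun x u => n%:~R * zeta x u.

End Instantons.

(* Main.v *)
Require Import Defs.
From HB Require Import structures.
From mathcomp Require Import all_boot all_order all_algebra spectral complex.
From mathcomp Require Import ring lra.
From mathcomp Require Import all_classical all_reals all_analysis.

(** By the Maurer-Cartan equation the curvature of A only involves the twelve
    coordinates e^07, e^12, e^34, e^56; e^05, e^13, e^24, e^67; e^06, e^14, e^23,
    e^57.  The linear equations *w = - Phi_L /\ w have rank 7, and on a form of
    this shape they reduce to one equation per block of four coordinates.  With
    y = r^2 p0 + n, the three equations say that y, p1 and p2 each satisfy
    (r^4 - 1) u' = 4 alpha r^3 u for a constant alpha depending on L and on the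
    block, so that u is a constant multiple of (r^4 - 1)^alpha. *)

Set Implicit Arguments.
Unset Strict Implicit.
Unset Printing Implicit Defensive.

Import Order.TTheory GRing.Theory Num.Theory.
Local Open Scope ring_scope.

(** * The linear algebra of the instanton equation *)

Section ExteriorComputation.
Variable R : realType.
Implicit Types (w : ext R) (l : seq nat).

(** The three blocks are the supports of omega_I, omega_K and omega_J, and they carry the curvature
    coming from kappa (with zeta), nu1 and nu2 respectively. In each [Phi_L] one square has a minus
    sign (omega_K for I, omega_I for J, omega_J for K), and the block of that form is the one with
    the positive exponent: 1 for y, or 1/2 for p1 or p2, instead of -1 and -3/2. The shift by n in y
    comes from n d zeta, which only feeds e^12 and e^34: it makes the equation for p0 inhomogeneous,
    with particular solution -n / r^2 for every L. Two obstacles shape the proof. The forms live in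
    a space of dimension 256 indexed by finite sets, so the linear system is computed on lists with
    integer coefficients and transferred back. And [spin7_instanton] only asks for some 2-covector
    pulling back to dA; it becomes a condition on the explicit curvature because the coframe takes
    arbitrary values on tangent vectors, which makes this covector unique. *)

Definition basis_form (S : {set 'I_8}) : ext R := [ffun T => (T == S)%:R].

Lemma scale_extE (c : R) w S : (c *: w : ext R) S = c * w S.
Proof. by rewrite ffunE. Qed.

Lemma wedge_basis_form (S T : {set 'I_8}) :
  wedge (basis_form S) (basis_form T) =
    if [disjoint S & T] then wsign R S T *: basis_form (S :|: T) else 0.
Proof.
apply/ffunP => U; rewrite !ffunE.
transitivity ((S \subset U)%:R * (wsign R S (U :\: S) * (U :\: S == T)%:R)).
  have [SU|SU] := boolP (S \subset U).
    rewrite (bigD1 S) //= !ffunE eqxx !mul1r big1 ?addr0 // => A /andP[_ AS].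
    by rewrite !ffunE (negPf AS) mul0r mulr0.
  rewrite mul0r big1 // => A AU; rewrite !ffunE.
  case: eqP => [AS|_]; last by rewrite mul0r mulr0.
  by rewrite -AS AU in SU.
have [dST|dST] := boolP [disjoint S & T]; rewrite !ffunE; last first.
  case: eqP => [e|_]; last by rewrite !mulr0.
  by case/negP: dST; rewrite -e; apply/pred0P => i; rewrite !inE; case: (i \in S).
have -> : (U == S :|: T) = (S \subset U) && (U :\: S == T).
  apply/eqP/andP => [->|[SU /eqP <-]].
    rewrite finset.subsetUl finset.setDUl finset.setDv finset.set0U.
    by rewrite (finset.setDidPl _) // disjoint_sym.
  apply/finset.setP => i; rewrite !inE.
  by case: (boolP (i \in S)) => // /(fintype.subsetP SU) ->.
case: (S \subset U) => /=; last by rewrite mul0r scaler0.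
rewrite mul1r.
by case: eqP => [->|_] //=; rewrite mulr0 scaler0.
Qed.

Lemma wedgeDl w1 w2 w : wedge (w1 + w2) w = wedge w1 w + wedge w2 w.
Proof.
apply/ffunP => S; rewrite !ffunE -big_split /=; apply: eq_bigr => A _.
by rewrite ffunE; ring.
Qed.

Lemma wedgeDr w1 w2 w : wedge w (w1 + w2) = wedge w w1 + wedge w w2.
Proof.
apply/ffunP => S; rewrite !ffunE -big_split /=; apply: eq_bigr => A _.
by rewrite ffunE; ring.
Qed.

Lemma wedgeZl (c : R) w1 w : wedge (c *: w1 : ext R) w = c *: (wedge w1 w : ext R).
Proof.
apply/ffunP => S; rewrite scale_extE !ffunE mulr_sumr; apply: eq_bigr => A _.
by rewrite scale_extE; ring.
Qed.

Lemma wedgeZr (c : R) w1 w : wedge w (c *: w1 : ext R) = c *: (wedge w w1 : ext R).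
Proof.
apply/ffunP => S; rewrite scale_extE !ffunE mulr_sumr; apply: eq_bigr => A _.
by rewrite scale_extE; ring.
Qed.

Lemma wedge0l w : wedge 0 w = 0 :> ext R.
Proof. by have := wedgeZl 0 0 w; rewrite !scale0r. Qed.

Lemma wedge0r w : wedge w 0 = 0 :> ext R.
Proof. by have := wedgeZr 0 0 w; rewrite !scale0r. Qed.

Lemma wedge_suml (I : Type) (s : seq I) (F : I -> ext R) w :
  wedge (\sum_(i <- s) F i) w = \sum_(i <- s) wedge (F i) w :> ext R.
Proof.
elim: s => [|i s IH]; first by rewrite !big_nil wedge0l.
by rewrite !big_cons wedgeDl IH.
Qed.

Lemma wedge_sumr (I : Type) (s : seq I) (F : I -> ext R) w :
  wedge w (\sum_(i <- s) F i) = \sum_(i <- s) wedge w (F i) :> ext R.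
Proof.
elim: s => [|i s IH]; first by rewrite !big_nil wedge0r.
by rewrite !big_cons wedgeDr IH.
Qed.

(** * Integer exterior algebra on lists of indices *)

Definition indices8 (p : pred nat) : seq nat := seq.filter p (iota 0 8).

Definition set_of (l : seq nat) : {set 'I_8} := [set i : 'I_8 | val i \in l].

(** The exponent of [wsign] as a sum over lists, in a form that reduces by computation. *)
Definition inversions l1 l2 : nat :=
  sumn [seq sumn [seq ([&& i \in l1, j \in l2 & (j < i)%N] : nat) | j <- iota 0 8]
       | i <- iota 0 8].

Definition sgn l1 l2 : int := if odd (inversions l1 l2) then -1 else 1.

Lemma wsign_set_of l1 l2 : wsign R (set_of l1) (set_of l2) = (sgn l1 l2)%:~R.
Proof.
rewrite /wsign (_ : #|_| = inversions l1 l2); last first.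
  transitivity (\sum_(i < 8) \sum_(j < 8)
    ([&& val i \in l1, val j \in l2 & (j < i)%N] : nat))%N.
    rewrite pair_bigA /= -sum1_card big_mkcond; apply: eq_bigr => -[i j] _.
    by rewrite !inE /=; case: ifP.
  rewrite /inversions sumnE big_map -[iota 0 8]/(index_iota 0 8) big_mkord.
  apply: eq_bigr => i _; rewrite sumnE big_map.
  by rewrite big_mkord.
by rewrite -signr_odd /sgn; case: odd; rewrite ?expr1 ?expr0.
Qed.

(* [(c, l)] stands for c e^l, with l an increasing list of indices; products of such
   sums are multiplied out by [vm_compute]. *)
Definition formal : Type := seq (int * seq nat).

Definition interp (L : formal) : ext R :=
  \sum_(t <- L) (t.1)%:~R *: basis_form (set_of t.2).

Definition fscale (c : int) (L : formal) : formal := [seq (c * t.1, t.2) | t <- L].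

(** Filtering [iota 0 8] sorts the union of the two lists, so every subset has a single list and the
    reordering sign is all in [sgn]. Equal terms are not collected; [fcoef] adds them up. *)
Definition fwedge (L1 L2 : formal) : formal :=
  flatten [seq pmap (fun t2 : int * seq nat =>
     if has (mem t1.2) t2.2 then None
     else Some (t1.1 * t2.1 * sgn t1.2 t2.2,
                indices8 (fun i => (i \in t1.2) || (i \in t2.2)))) L2 | t1 <- L1].

Lemma interp_cat L1 L2 : interp (L1 ++ L2) = interp L1 + interp L2.
Proof. by rewrite /interp big_cat. Qed.

Lemma interp_scale c L : interp (fscale c L) = c%:~R *: interp L.
Proof.
rewrite /interp big_map scaler_sumr; apply: eq_bigr => t _.
by rewrite scalerA /= intrM.
Qed.

(** [set_of] forgets entries above 7, so a shared index out of range would make [fwedge] drop a term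
    that [wedge] keeps. Excluding such indices from one factor is enough. *)
Definition wf (L : formal) := all (fun t : int * seq nat => all (gtn 8) t.2) L.

Lemma set_of_indices8 p : set_of (indices8 p) = [set i : 'I_8 | p i].
Proof.
apply/finset.setP => i; rewrite !inE mem_filter mem_iota /= add0n ltn_ord andbT.
by [].
Qed.

Lemma interp_wedge L1 L2 : wf L2 -> interp (fwedge L1 L2) = wedge (interp L1) (interp L2).
Proof.
move=> wf2; rewrite /interp /fwedge big_flatten /= big_map wedge_suml.
apply: eq_bigr => t1 _; rewrite wedgeZl wedge_sumr.
elim: L2 wf2 => [|t2 L2 IH]; first by rewrite !big_nil scaler0.
move=> /= /andP[wft2 /IH{}IH]; rewrite big_cons scalerDr -IH {IH} wedgeZr wedge_basis_form.
have -> : [disjoint set_of t1.2 & set_of t2.2] = ~~ has (mem t1.2) t2.2.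
  rewrite -finset.setI_eq0; apply/eqP/hasPn => [e i it2|h].
    apply/negP => /= it1; have i8 : (i < 8)%N by exact: (allP wft2).
    by have := finset.in_set0 (Ordinal i8); rewrite -e !inE /= it1 it2.
  apply/finset.setP => i; rewrite !inE; apply/negP => /andP[i1 /h /=].
  by rewrite i1.
case: ifP => /= [_|_]; first by rewrite !scaler0 add0r.
rewrite big_cons /= wsign_set_of set_of_indices8 !scalerA !intrM; congr (_ *: basis_form _ + _).
by apply/finset.setP => i; rewrite !inE.
Qed.

Definition pairs : seq (seq nat) :=
  [seq [:: i; j] | i <- iota 0 8, j <- [seq j <- iota 0 8 | (i < j)%N]].

Definition fcoef (L : formal) l : int :=
  foldr (fun t c => if t.2 == l then t.1 + c else c) 0 L.

Fixpoint sublists (s : seq nat) : seq (seq nat) :=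
  if s is i :: s' then map (cons i) (sublists s') ++ sublists s' else [:: [::]].

Definition subsets8 := sublists (iota 0 8).

Lemma filter_sublists (p : pred nat) s : seq.filter p s \in sublists s.
Proof.
elim: s => [|i s IH] //=; rewrite mem_cat.
by case: (p i); rewrite ?IH ?orbT // map_f.
Qed.

(** Inverse of [set_of] on the 256 increasing lists of [subsets8]: facts about all subsets become
    Boolean checks over that list. *)
Definition list_of (S : {set 'I_8}) : seq nat := indices8 (fun i => inord i \in S).

Lemma list_of_subset S : list_of S \in subsets8.
Proof. exact: filter_sublists. Qed.

Lemma list_ofK S : set_of (list_of S) = S.
Proof. by rewrite set_of_indices8; apply/finset.setP => i; rewrite inE inord_val. Qed.

Lemma list_of_set_of l : l \in subsets8 -> list_of (set_of l) = l.
Proof.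
move=> ls; transitivity (indices8 (mem l)).
  apply: eq_in_filter => i; rewrite mem_iota add0n => /andP[_ i8].
  by rewrite inE /= inordK.
have : all (fun l => indices8 (mem l) == l) subsets8 by vm_compute.
by move=> /allP/(_ _ ls)/eqP.
Qed.

Lemma eq_set_of S l : l \in subsets8 -> (S == set_of l) = (list_of S == l).
Proof.
move=> ls; apply/eqP/eqP => [->|<-]; first exact: list_of_set_of.
by rewrite list_ofK.
Qed.

Lemma list_of_compl S : list_of (~: S) = indices8 (fun i => i \notin list_of S).
Proof.
apply: eq_in_filter => i i8; rewrite finset.in_setC mem_filter i8 andbT.
by [].
Qed.

Lemma size_list_of S : size (list_of S) = #|S|.
Proof.
rewrite size_filter -sum1_count big_mkcond -[iota 0 8]/(index_iota 0 8) big_mkord.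
by rewrite -sum1_card [RHS]big_mkcond; apply: eq_bigr => i _; rewrite inord_val.
Qed.

Lemma pairs_subsets8 q : q \in pairs -> q \in subsets8.
Proof.
have : all (mem subsets8) pairs by vm_compute.
by move=> /allP h /h.
Qed.

Lemma list_of_pairs S : (list_of S \in pairs) = (#|S| == 2%N).
Proof.
rewrite -size_list_of.
have : all (fun l => (l \in pairs) == (size l == 2%N)) subsets8 by vm_compute.
by move=> /allP/(_ _ (list_of_subset S))/eqP.
Qed.

Lemma sum_pairs w S : (forall T : {set 'I_8}, #|T| != 2%N -> w T = 0) ->
  w S = \sum_(q <- pairs) (list_of S == q)%:R * w (set_of q).
Proof.
move=> w2; have [S2|S2] := boolP (list_of S \in pairs); last first.
  rewrite w2 -?list_of_pairs // big_seq big1 // => q qp.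
  by case: eqP S2 => [->|]; rewrite ?qp ?mul0r.
rewrite (bigD1_seq (list_of S)) //= eqxx mul1r list_ofK big1 ?addr0 //.
by move=> q qS; rewrite eq_sym (negPf qS) mul0r.
Qed.

Lemma pairs_expand w : (forall T : {set 'I_8}, #|T| != 2%N -> w T = 0) ->
  w = \sum_(q <- pairs) w (set_of q) *: basis_form (set_of q).
Proof.
move=> w2; apply/ffunP => S; rewrite sum_ffunE (sum_pairs S w2).
rewrite [LHS]big_seq [RHS]big_seq; apply: eq_bigr => q qp.
by rewrite scale_extE ffunE eq_set_of ?pairs_subsets8 // mulrC.
Qed.

Lemma interp_fcoef L S : all (fun t : int * seq nat => t.2 \in subsets8) L ->
  interp L S = (fcoef L (list_of S))%:~R.
Proof.
rewrite /interp sum_ffunE; elim: L => [|t L IH] /=; first by rewrite big_nil.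
move=> /andP[ts /IH{}IH]; rewrite big_cons scale_extE ffunE IH eq_set_of // eq_sym.
by case: eqP => _; rewrite ?mulr1 ?mulr0 ?add0r // intrD.
Qed.

Lemma fwedge_subsets L1 L2 :
  all (fun t : int * seq nat => t.2 \in subsets8) (fwedge L1 L2).
Proof.
apply/allP => t /flattenP[s /mapP[t1 _ ->]]; rewrite mem_pmap => /mapP[t2 _].
by case: ifP => // _ [->] /=; exact: filter_sublists.
Qed.

(** * The instanton equation as a system of integer rows *)

Definition wedge_table (L : formal) : seq (seq nat * formal) :=
  [seq (q, fwedge L [:: (1, q)]) | q <- pairs].

(* If T is the wedge table of L, the coefficient of e^l in [2 *w + L /\ w] as a linear
   form in the coordinates of [w]. *)
Definition row (T : seq (seq nat * formal)) l : formal :=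
  [seq t <- [seq ((indices8 (fun i => i \notin l) == t.1)%:R * (2 * sgn t.1 l)
                  + fcoef t.2 l, t.1) | t <- T] | t.1 != 0].

Definition rows (L : formal) : seq formal :=
  let T := wedge_table L in [seq row T l | l <- subsets8].

Lemma hodge_wedgeE L (Phi : ext R) w :
  Phi = 2^-1 *: interp L ->
  (forall T : {set 'I_8}, #|T| != 2%N -> w T = 0) ->
  hodge w = - wedge Phi w <->
  (forall r, r \in rows L -> \sum_(t <- r) (t.1)%:~R * w (set_of t.2) = 0).
Proof.
move=> -> w2.
(* The factor 2 clears the 1/2 in [Phi], so that all row coefficients are integers. *)
have E S : \sum_(t <- row (wedge_table L) (list_of S)) (t.1)%:~R * w (set_of t.2)
   = 2 * (hodge w S + wedge (2^-1 *: interp L : ext R) w S).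
  rewrite big_filter -map_comp big_map.
  transitivity (\sum_(q <- pairs)
     ((list_of (~: S) == q)%:R * (2 * sgn q (list_of S))
      + fcoef (fwedge L [:: (1, q)]) (list_of S))%:~R * w (set_of q)).
    rewrite big_mkcond; apply: eq_bigr => q _ /=; rewrite list_of_compl.
    by case: eqP => // ->; rewrite mul0r.
  rewrite wedgeZl mulrDr [hodge w S]ffunE [X in _ + 2 * X]scale_extE.
  rewrite [2 * (2^-1 * _)]mulrA mulfV ?pnatr_eq0 // mul1r.
  have -> : wedge (interp L) w S =
      \sum_(q <- pairs) wedge (interp L) (w (set_of q) *: basis_form (set_of q) : ext R) S.
    by rewrite [in LHS](pairs_expand w2) wedge_sumr sum_ffunE.
  rewrite (sum_pairs (~: S) w2) mulr_sumr mulr_sumr -big_split /=.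
  rewrite [LHS]big_seq [RHS]big_seq; apply: eq_bigr => q qp.
  have -> : wedge (interp L) (w (set_of q) *: basis_form (set_of q) : ext R) S
     = w (set_of q) * (fcoef (fwedge L [:: (1, q)]) (list_of S))%:~R.
    rewrite wedgeZr scale_extE; congr (_ * _); rewrite -interp_fcoef ?fwedge_subsets //.
    rewrite interp_wedge; first by rewrite /interp big_seq1 /= scale1r.
    rewrite /wf /= andbT; have : all (all (gtn 8)) pairs by vm_compute.
    by move=> /allP/(_ _ qp).
  rewrite rmorphD /= mulrDl [w _ * _]mulrC; congr (_ + _).
  case: eqP => [<-|_]; last by rewrite /= !mul0r !mulr0.
  by rewrite /= !mul1r -(list_ofK S) -[~: _]list_ofK wsign_set_of !list_ofK intrM; ring.
split => [h r rL|h].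
  case/mapP: rL => l ls ->; rewrite -(list_of_set_of ls) E h.
  by rewrite ffunE addNr mulr0.
apply/ffunP => S; apply/eqP; rewrite [X in _ == X]ffunE -addr_eq0.
have /eqP := E S; rewrite h; last by apply/map_f/list_of_subset.
by rewrite eq_sym mulf_eq0 pnatr_eq0.
Qed.

Lemma set_of_pair i j : (i < 8)%N -> (j < 8)%N ->
  set_of [:: i; j] = [set inord i; inord j].
Proof.
move=> i8 j8; apply/finset.setP => k; rewrite !inE.
by rewrite -[k == inord i]val_eqE -[k == inord j]val_eqE /= !inordK.
Qed.

Definition fomega_I : formal :=
  [:: (-1, [:: 0; 7]%N); (1, [:: 5; 6]%N); (1, [:: 1; 2]%N); (-1, [:: 3; 4]%N)].
Definition fomega_J : formal :=
  [:: (-1, [:: 0; 6]%N); (-1, [:: 5; 7]%N); (-1, [:: 2; 3]%N); (1, [:: 1; 4]%N)].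
Definition fomega_K : formal :=
  [:: (1, [:: 0; 5]%N); (-1, [:: 6; 7]%N); (1, [:: 2; 4]%N); (1, [:: 1; 3]%N)].

Lemma e2_basis_form i j : (i < j)%N -> (j < 8)%N ->
  e2 R i j = basis_form (set_of [:: i; j]).
Proof.
move=> ij j8; have i8 := ltn_trans ij j8.
have e1E k : (k < 8)%N -> e1 R k = basis_form (set_of [:: k]).
  move=> k8; apply/ffunP => S; rewrite !ffunE; congr (_ == _)%:R.
  apply/finset.setP => m; rewrite !inE.
  by rewrite -[m == inord k]val_eqE /= inordK.
rewrite /e2 !e1E // wedge_basis_form.
have -> : [disjoint set_of [:: i] & set_of [:: j]].
  apply/pred0P => k; rewrite !inE; apply/negP => /andP[/eqP -> /eqP ij'].
  by rewrite ij' ltnn in ij.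
rewrite /wsign (_ : #|_| = 0%N) ?scale1r; last first.
  apply/eqP; rewrite cards_eq0; apply/eqP/finset.setP => -[k m]; rewrite !inE /=.
  by apply/negP => /and3P[/eqP -> /eqP ->]; rewrite ltnNge (ltnW ij).
by congr basis_form; apply/finset.setP => k; rewrite !inE.
Qed.

Lemma omega_interp :
  [/\ omega_I R = interp fomega_I, omega_J R = interp fomega_J
    & omega_K R = interp fomega_K].
Proof.
by split; rewrite /omega_I /omega_J /omega_K !e2_basis_form // /interp !big_cons big_nil
  ?mulrN1z ?mulr1z ?scaleN1r ?scale1r ?addr0 ?addrA.
Qed.

Definition fPhi (sI sJ sK : int) (L1 L2 L3 : formal) : formal :=
  fscale sI (fwedge L1 L1) ++ (fscale sJ (fwedge L2 L2) ++ fscale sK (fwedge L3 L3)).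

Lemma fPhi_interp sI sJ sK L1 L2 L3 : wf L1 -> wf L2 -> wf L3 ->
  interp (fPhi sI sJ sK L1 L2 L3) =
    sI%:~R *: (wedge (interp L1) (interp L1) : ext R)
    + sJ%:~R *: (wedge (interp L2) (interp L2) : ext R)
    + sK%:~R *: (wedge (interp L3) (interp L3) : ext R).
Proof.
move=> wf1 wf2 wf3; rewrite /fPhi !interp_cat !interp_scale !interp_wedge //.
by rewrite addrA.
Qed.

Definition interp_row (w : ext R) (r : formal) : R :=
  \sum_(t <- r) (t.1)%:~R * w (set_of t.2).

Lemma interp_row_scale w c r : interp_row w (fscale c r) = c%:~R * interp_row w r.
Proof.
rewrite /interp_row big_map mulr_sumr; apply: eq_bigr => t _.
by rewrite intrM mulrA.
Qed.

(** For the systems of the [Phi_L] this already reaches the rank: rows of degree other than 6 are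
    empty, and the 28 others fall into seven groups of four that agree up to sign. *)
Definition reduce_rows (rs : seq formal) : seq formal :=
  foldr (fun r acc => if [|| nilp r, r \in acc | fscale (-1) r \in acc]
                      then acc else r :: acc) [::] rs.

Lemma reduce_rowsP w rs :
  {in rs, forall r, interp_row w r = 0} <->
  {in reduce_rows rs, forall r, interp_row w r = 0}.
Proof.
elim: rs => [|r rs [IH1 IH2]] //=.
have negE r' : interp_row w (fscale (-1) r') = 0 -> interp_row w r' = 0.
  by rewrite interp_row_scale mulrN1z mulN1r => /eqP; rewrite oppr_eq0 => /eqP.
split=> h.
  have h' : {in reduce_rows rs, forall r, interp_row w r = 0}.
    by apply: IH1 => r' r'rs; apply: h; rewrite inE r'rs orbT.
  case: ifP => _ // r'; rewrite inE => /predU1P[->|/h' //].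
  by apply: h; rewrite mem_head.
have h' : {in reduce_rows rs, forall r, interp_row w r = 0}.
  by move=> r' r'rs; apply: h; case: ifP => // _; rewrite inE r'rs orbT.
move=> r'; rewrite inE => /predU1P[->|r'rs]; last exact: IH2.
case: ifP h => [/or3P[/nilP ->|r1|r1] _|_ h]; last by apply: h; rewrite mem_head.
- by rewrite /interp_row big_nil.
- exact: h'.
- exact/negE/h'.
Qed.

Definition interpR (s : seq (R * seq nat)) : ext R :=
  \sum_(t <- s) t.1 *: basis_form (set_of t.2).

Lemma interpR_set_of s q : q \in subsets8 -> all (mem subsets8) (map snd s) ->
  interpR s (set_of q) = foldr (fun t c => if q == t.2 then t.1 + c else c) 0 s.
Proof.
move=> qs; rewrite /interpR sum_ffunE; elim: s => [|t s IH].
  by rewrite big_nil.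
move=> /andP[ts /IH{}IH]; rewrite big_cons scale_extE ffunE IH eq_set_of // list_of_set_of //=.
by case: eqP => _; rewrite ?mulr1 ?mulr0 ?add0r.
Qed.

(** * The instanton equation on the three blocks *)

Section BlockForm.
Variables w07 w12 w34 w56 w05 w13 w24 w67 w06 w14 w23 w57 : R.

(** The lines are the supports of omega_I, omega_K and omega_J, each a partition of the indices into
    four pairs. The terms of [Phi_L] are indexed by unions of two pairs of one line, so among these
    coordinates the equation couples only those of the same line. *)
Definition block_form_seq : seq (R * seq nat) :=
  [:: (w07, [:: 0; 7]%N); (w12, [:: 1; 2]%N); (w34, [:: 3; 4]%N); (w56, [:: 5; 6]%N);
      (w05, [:: 0; 5]%N); (w13, [:: 1; 3]%N); (w24, [:: 2; 4]%N); (w67, [:: 6; 7]%N);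
      (w06, [:: 0; 6]%N); (w14, [:: 1; 4]%N); (w23, [:: 2; 3]%N); (w57, [:: 5; 7]%N)].

Definition block_form : ext R := interpR block_form_seq.

Lemma block_form_support (T : {set 'I_8}) : #|T| != 2%N -> block_form T = 0.
Proof.
move=> T2; rewrite /block_form /interpR sum_ffunE big_seq big1 // => t ts.
rewrite scale_extE ffunE; case: eqP => [Tq|]; rewrite ?mulr0 //.
have qp : t.2 \in pairs.
  have : all (mem pairs) (map snd block_form_seq) by vm_compute.
  by move=> /allP; apply; exact: map_f.
by move: T2; rewrite -list_of_pairs Tq list_of_set_of ?qp ?pairs_subsets8.
Qed.

Lemma block_formE q : q \in subsets8 ->
  block_form (set_of q) = foldr (fun t c => if q == t.2 then t.1 + c else c) 0 block_form_seq.
Proof. by move=> qs; apply: interpR_set_of => //; vm_compute. Qed.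

Lemma hodge_block_form (Phi : ext R) sI sJ sK :
  Phi = 2^-1 *: (sI%:~R *: (wedge (omega_I R) (omega_I R) : ext R)
                 + sJ%:~R *: (wedge (omega_J R) (omega_J R) : ext R)
                 + sK%:~R *: (wedge (omega_K R) (omega_K R) : ext R)) ->
  hodge block_form = - wedge Phi block_form <->
  foldr (fun r P => interp_row block_form r = 0 /\ P) True
    (reduce_rows (rows (fPhi sI sJ sK fomega_I fomega_J fomega_K))).
Proof.
set L := fPhi _ _ _ _ _ _; have [-> -> ->] := omega_interp.
rewrite -(@fPhi_interp sI sJ sK fomega_I fomega_J fomega_K isT isT isT) -/L => PhiE.
apply: (iff_trans (hodge_wedgeE PhiE block_form_support)).
apply: (iff_trans (reduce_rowsP _ _)).
elim: (reduce_rows (rows L)) => [|r rs [IH1 IH2]]; first by split.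
split=> [h|[r0 /IH2 h] r']; last by rewrite inE => /predU1P[->|/h].
split; first by apply: h; rewrite mem_head.
by apply: IH1 => r' r'rs; apply: h; rewrite inE r'rs orbT.
Qed.

Ltac solve_block_form :=
  [> by rewrite !mulr1z mulrN1z !scale1r scaleN1r |];
  (* Only the integer rows are evaluated; the real coordinates stay symbolic. *)
  match goal with |- context [reduce_rows ?rs] =>
    let b := eval vm_compute in (reduce_rows rs) in
    have -> : reduce_rows rs = b by vm_compute
  end;
  rewrite /foldr /interp_row !big_cons !big_nil !block_formE //= ?NegzE;
  (* The first three rows are those of the blocks; the others only involve coordinates that vanish
     on [block_form]. *)
  split=> [[h1 [h2 [h3 _]]]|[h1 h2 h3]]; repeat split; lra.

Lemma instanton_block_form_I :
  hodge block_form = - wedge (Phi_I R) block_form <->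
  [/\ w07 - w12 + w34 - w56 = 0, w05 - w13 - w24 - w67 = 0 & w06 - w14 + w23 + w57 = 0].
Proof. apply: (iff_trans (@hodge_block_form _ 1 1 (-1) _)); solve_block_form. Qed.

Lemma instanton_block_form_J :
  hodge block_form = - wedge (Phi_J R) block_form <->
  [/\ w07 + w12 - w34 - w56 = 0, w05 + w13 + w24 - w67 = 0 & w06 - w14 + w23 + w57 = 0].
Proof. apply: (iff_trans (@hodge_block_form _ (-1) 1 1 _)); solve_block_form. Qed.

Lemma instanton_block_form_K :
  hodge block_form = - wedge (Phi_K R) block_form <->
  [/\ w07 - w12 + w34 - w56 = 0, w05 + w13 + w24 - w67 = 0 & w06 + w14 - w23 + w57 = 0].
Proof. apply: (iff_trans (@hodge_block_form _ 1 (-1) 1 _)); solve_block_form. Qed.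

End BlockForm.

End ExteriorComputation.

(** * The curvature of an invariant connection *)

Local Open Scope sesquilinear_scope.
(* [mathcomp] has another [eta]. *)
Local Notation eta := Defs.eta.

Section MaurerCartan.
Variable R : realType.
Implicit Types (x u v : ambient R) (h X Y : 'M[R[i]]_3).

Lemma pullback_interpR (s : seq (R * seq nat)) (F : nat -> nat -> R) :
  all (mem pairs) (map snd s) ->
  \sum_(i < 8) \sum_(j < 8 | (i < j)%N) interpR s [set i; j] * F i j =
  \sum_(t <- s) t.1 * F (nth 0%N t.2 0) (nth 0%N t.2 1).
Proof.
rewrite /interpR => /allP sp.
transitivity (\sum_(i < 8) \sum_(j < 8 | (i < j)%N) \sum_(t <- s)
   t.1 * (([:: val i; val j] == t.2)%:R * F i j)).
  apply: eq_bigr => i _; apply: eq_bigr => j ij.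
  rewrite sum_ffunE mulr_suml big_seq [RHS]big_seq; apply: eq_bigr => t ts.
  have ijp : [:: val i; val j] \in pairs.
    by apply: allpairs_f_dep; rewrite ?mem_filter ?mem_iota ?ij /=.
  rewrite scale_extE ffunE -mulrA eq_set_of; last exact/pairs_subsets8/sp/map_f.
  rewrite -[i in LHS]inord_val -[j in LHS]inord_val -set_of_pair //.
  by rewrite list_of_set_of ?pairs_subsets8 // !inord_val.
under eq_bigr do rewrite exchange_big.
rewrite exchange_big big_seq [RHS]big_seq /=; apply: eq_bigr => t ts.
have /allpairsPdep[a [b [a8 + ->]]] : t.2 \in pairs by exact/sp/map_f.
rewrite mem_filter !mem_iota /= add0n in a8 * => /andP[ab b8].
under eq_bigr do rewrite -mulr_sumr.
rewrite -mulr_sumr; congr (_ * _).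
rewrite (bigD1 (Ordinal a8)) //= (bigD1 (Ordinal b8)) //= eqxx mul1r !big1 ?addr0 //.
  move=> i ia; rewrite big1 // => j _; case: eqP => [[ia' _]|]; last by rewrite mul0r.
  by rewrite -val_eqE /= ia' eqxx in ia.
move=> j /andP[_ jb]; case: eqP => [[jb']|]; last by rewrite mul0r.
by rewrite -val_eqE /= jb' eqxx in jb.
Qed.

(** * The Maurer-Cartan equation in coordinates of su(3) *)

Definition mc (z k n1 n2 s1 s2 m1 m2 : R) : 'M[R[i]]_3 :=
  \matrix_(i < 3, j < 3) nth 0 (nth [::]
    [:: [:: Complex 0 (z + k); Complex n1 n2; Complex s1 s2];
        [:: Complex (- n1) n2; Complex 0 (z - k); Complex m1 m2];
        [:: Complex (- s1) s2; Complex (- m1) m2; Complex 0 (- 2 * z)]] i) j.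

Lemma mc_su3 z k n1 n2 s1 s2 m1 m2 : su3 (mc z k n1 n2 s1 s2 m1 m2).
Proof.
split.
  apply/matrixP => -[[|[|[|i]]] i3] // -[[|[|[|j]]] j3] //; rewrite !mxE /=;
  by apply/eqP; rewrite eq_complex /= ?opprK ?oppr0 ?opprD ?eqxx.
rewrite /mxtrace !big_ord_recl big_ord0 !mxE /=; apply/eqP.
by rewrite eq_complex /=; apply/andP; split; apply/eqP; ring.
Qed.

Lemma ord3P (i : 'I_3) : [\/ i = 0, i = 1 | i = 2].
Proof. by case: i => -[|[|[|i]]] // i3; constructor; apply: val_inj. Qed.

Lemma sum3 (V : nmodType) (F : 'I_3 -> V) : \sum_i F i = F 0 + F 1 + F 2.
Proof.
rewrite !big_ord_recl big_ord0 addr0 addrA; congr (_ + F _ + F _); exact: val_inj.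
Qed.

Lemma su3_mc X : su3 X ->
  X = mc (- complex.Im (X 2 2) / 2) ((complex.Im (X 0 0) - complex.Im (X 1 1)) / 2)
         (complex.Re (X 0 1)) (complex.Im (X 0 1)) (complex.Re (X 0 2)) (complex.Im (X 0 2))
         (complex.Re (X 1 2)) (complex.Im (X 1 2)).
Proof.
move=> [/matrixP skew tr0].
have S i j : complex.Re (X j i) = - complex.Re (X i j) /\
             complex.Im (X j i) = complex.Im (X i j).
  have /eqP := skew i j; rewrite !mxE; case: (X j i) (X i j) => [a b] [c d] /=.
  by rewrite eq_complex /= eqr_opp => /andP[/eqP -> /eqP ->].
have D i : complex.Re (X i i) = 0.
  by have [/eqP] := S i i; rewrite -addr_eq0 -mulr2n mulrn_eq0 /= => /eqP.
have T : complex.Im (X 0 0) + complex.Im (X 1 1) + complex.Im (X 2 2) = 0.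
  by move: tr0; rewrite /mxtrace sum3 -!raddfD /= => ->.
apply/matrixP => i j.
have XE : X i j = Complex (complex.Re (X i j)) (complex.Im (X i j)) by case: (X i j).
rewrite mxE XE.
have [->|->|->] := ord3P i; have [->|->|->] := ord3P j => /=; rewrite ?D //.
- by congr Complex; lra.
- by have [-> ->] := S 0 1.
- by congr Complex; lra.
- by have [-> ->] := S 0 2.
- by have [-> ->] := S 1 2.
- by congr Complex; lra.
Qed.

Lemma eta_mc x u : tangent x u -> eta x u =
  mc (zeta x u) (kappa x u) (nu1 x u) (nu2 x u) (sigma1 x u) (sigma2 x u) (mu1 x u) (mu2 x u).
Proof. exact: su3_mc. Qed.

Lemma mc_forms x u z k n1 n2 s1 s2 m1 m2 : eta x u = mc z k n1 n2 s1 s2 m1 m2 ->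
  [/\ zeta x u = z, kappa x u = k, nu1 x u = n1 & nu2 x u = n2] /\
  [/\ sigma1 x u = s1, sigma2 x u = s2, mu1 x u = m1 & mu2 x u = m2].
Proof.
rewrite /zeta /kappa /nu1 /nu2 /sigma1 /sigma2 /mu1 /mu2 => ->.
by rewrite !mxE /=; split; split=> //; field.
Qed.

Lemma SU3_adjK h : SU3 h -> h ^t* *m h = 1%:M.
Proof. by move=> [/unitarymxP /mulmx1C]. Qed.

Lemma eta_translate x u v t :
  eta (translate x t u) v = eta x v + Complex t 0 *: eta u v.
Proof.
rewrite /eta /translate /= linearD /= linearZ /= map_mxD map_mxZ /= mulmxDl.
congr (_ + _); rewrite -scalemxAl; congr (_ *: _).
by apply/eqP; rewrite eq_complex /= oppr0 !eqxx.
Qed.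

(* The Maurer-Cartan form is R-affine in its base point: [zeta u v], with the vector [u] in
   the place of the point, is the derivative of [zeta _ v] along [u]. *)
Lemma forms_translate x u v t :
  [/\ zeta (translate x t u) v = zeta x v + t * zeta u v,
      kappa (translate x t u) v = kappa x v + t * kappa u v,
      nu1 (translate x t u) v = nu1 x v + t * nu1 u v
    & nu2 (translate x t u) v = nu2 x v + t * nu2 u v].
Proof.
have E i j : complex.Re (eta (translate x t u) v i j) =
      complex.Re (eta x v i j) + t * complex.Re (eta u v i j) /\
    complex.Im (eta (translate x t u) v i j) =
      complex.Im (eta x v i j) + t * complex.Im (eta u v i j).
  rewrite eta_translate; move: (eta x v) (eta u v) => X Y; rewrite !mxE.
  case: (X i j) (Y i j) => [a b] [c d].
  have -> : Complex a b + Complex t 0 * Complex c d =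
    Complex (a + (t * c - 0 * d)) (b + (t * d + 0 * c)) by [].
  by rewrite /= !mul0r subr0 addr0.
split.
- by rewrite /zeta (E 2 2).2 opprD mulrDl -[in LHS]mulrN -mulrA.
- rewrite /kappa (E 0 0).2 (E 1 1).2; move: (complex.Im _) (complex.Im _) => a b.
  by move: (complex.Im _) (complex.Im _) => c d; field.
- by rewrite /nu1 (E 0 1).1.
- by rewrite /nu2 (E 0 1).2.
Qed.

(** By [forms_translate] the left sides are d zeta, d kappa, d nu1 and d nu2 at [x], so these are
    entries of d eta = - eta /\ eta. *)
Lemma maurer_cartan x u v : inM x -> tangent x u -> tangent x v ->
  let W (a b : form1 R) := a x u * b x v - a x v * b x u in
  [/\ zeta u v - zeta v u = - W (@sigma1 R) (@sigma2 R) - W (@mu1 R) (@mu2 R),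
      kappa u v - kappa v u = - 2 * W (@nu1 R) (@nu2 R) - W (@sigma1 R) (@sigma2 R)
                              + W (@mu1 R) (@mu2 R),
      nu1 u v - nu1 v u = 2 * W (@kappa R) (@nu2 R) + W (@sigma1 R) (@mu1 R)
                          + W (@sigma2 R) (@mu2 R)
    & nu2 u v - nu2 v u = - 2 * W (@kappa R) (@nu1 R) + W (@sigma2 R) (@mu1 R)
                          - W (@sigma1 R) (@mu2 R)].
Proof.
move=> xM ut vt W.
have hK : x.2 *m x.2 ^t* = 1%:M by apply/unitarymxP; case: xM => _ [].
(* With h = [x.2] unitary, a = h eta(a) and b = h eta(b), so the adjoint of a times b is eta(a)^*
   eta(b), which is - eta(a) eta(b) as eta(a) is skew-Hermitian. *)
have etaE a b : tangent x a -> eta a b = - eta x a *m eta x b.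
  move=> [skew _]; rewrite -skew /Defs.eta.
  rewrite trmx_mul map_mxM /= trmxCK mulmxA -[_ *m x.2 *m _]mulmxA.
  by rewrite hK mulmx1.
rewrite [zeta u v]/zeta [zeta v u]/zeta [kappa u v]/kappa [kappa v u]/kappa.
rewrite [nu1 u v]/nu1 [nu1 v u]/nu1 [nu2 u v]/nu2 [nu2 v u]/nu2.
rewrite (etaE u v) // (etaE v u) // (eta_mc ut) (eta_mc vt) /W.
move: (zeta x u) (kappa x u) (nu1 x u) (nu2 x u) (sigma1 x u) (sigma2 x u) (mu1 x u) (mu2 x u).
move: (zeta x v) (kappa x v) (nu1 x v) (nu2 x v) (sigma1 x v) (sigma2 x v) (mu1 x v) (mu2 x v).
move=> *; rewrite !mxE !sum3 !mxE /=.
by split; field.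
Qed.

End MaurerCartan.

(** * The curvature in the Calabi coframe *)

Section Connection.
Variable R : realType.
Implicit Types (x u v : ambient R) (h X Y : 'M[R[i]]_3).

Lemma exprn4_subr1_gt0 (r : R) : 1 < r -> 0 < r ^+ 4 - 1.
Proof. by move=> r1; rewrite subr_gt0 exprn_egt1. Qed.

Lemma coframe_onto x (c : nat -> R) : inM x ->
  exists2 u, tangent x u & forall j, (j < 8)%N -> coframe j x u = c j.
Proof.
move=> xM; have [r1 hSU] := xM; set r := x.1 in r1.
have r4 := exprn4_subr1_gt0 r1; have r0 : 0 < r by lra.
have r2 : 0 < r ^+ 2 - 1 by rewrite subr_gt0 exprn_egt1.
pose a := Num.sqrt ((r ^+ 2 - 1) / 2); pose b := Num.sqrt ((r ^+ 2 + 1) / 2).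
pose f := r^-1 * Num.sqrt (r ^+ 4 - 1); pose g := Num.sqrt (r ^+ 4 / (r ^+ 4 - 1)).
have a0 : a != 0 by rewrite gt_eqF // sqrtr_gt0 divr_gt0.
have b0 : b != 0 by rewrite gt_eqF // sqrtr_gt0 divr_gt0 // addr_gt0 // exprn_gt0.
have f0 : f != 0 by rewrite gt_eqF // mulr_gt0 ?invr_gt0 ?sqrtr_gt0.
have g0 : g != 0 by rewrite gt_eqF // sqrtr_gt0 divr_gt0 // exprn_gt0.
(* No coframe element sees zeta, the direction of K_0, so its value 0 is an arbitrary choice. *)
pose X := mc 0 (c 7 / f) (c 5 / r) (c 6 / r) (c 1 / a) (c 2 / a) (c 3 / b) (c 4 / b).
pose u : ambient R := (c 0 / g, x.2 *m X).
have etaE : eta x u = X by rewrite /Defs.eta /= mulmxA SU3_adjK // mul1mx.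
exists u; first by rewrite /tangent -/(eta x u) etaE; exact: mc_su3.
have [[zE kE n1E n2E] [s1E s2E m1E m2E]] := mc_forms etaE.
move=> j j8; rewrite /coframe kE n1E n2E s1E s2E m1E m2E -/r -/a -/b -/f -/g.
by case: j j8 => [|[|[|[|[|[|[|[|j]]]]]]]] //= _; rewrite mulrC divfK // gt_eqF.
Qed.

(** Evaluating [F] on tangent vectors dual to e^i and e^j reads off the coordinate of e^ij. *)
Lemma pullback2_unique x (w w' : ext R) F : inM x ->
  pullback2 x w F -> pullback2 x w' F -> w = w'.
Proof.
move=> xM.
suff H (i j : 'I_8) : (i < j)%N -> exists u v, [/\ tangent x u, tangent x v
     & forall w1 : ext R, pullback2 x w1 F -> F u v = w1 [set i; j]].
  move=> wF w'F; apply/ffunP => S; have [S2|S2] := boolP (#|S| == 2%N); last first.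
    by rewrite (wF.1 S S2) (w'F.1 S S2).
  have [i [j [ij ->]]] : exists i j : 'I_8, (i < j)%N /\ S = [set i; j].
    case/cards2P: S2 => i [j [ij ->]]; case: (ltnP i j) => ij'; first by exists i; exists j.
    exists j; exists i; split; last by rewrite finset.setUC.
    by rewrite ltn_neqAle ij' andbT eq_sym.
  by have [u [v [ut vt H']]] := H i j ij; rewrite -(H' _ wF) -(H' _ w'F).
move=> ij.
have [u ut uE] := coframe_onto (fun k => (k == i :> nat)%:R) xM.
have [v vt vE] := coframe_onto (fun k => (k == j :> nat)%:R) xM.
exists u, v; split => // w1 [_ ->] //.
rewrite (bigD1 i) //= (bigD1 j) //= !uE ?vE // !eqxx.
rewrite (ltn_eqF ij) /= !mulr0 subr0 !mulr1.
rewrite !big1 ?addr0 // => [k ki|k /andP[ik kj]].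
  rewrite big1 // => l kl; rewrite !uE ?vE // [(k == i :> nat)]val_eqE (negPf ki) !mul0r.
  have [li|li] := eqVneq (l : nat) i; last by rewrite mul0r subrr mulr0.
  by rewrite ltn_eqF ?mulr0 ?subrr ?mulr0 // (leq_trans kl) // li ltnW.
rewrite ?uE ?vE // ?eqxx [(k == j :> nat)]val_eqE (negPf kj) [(k == i :> nat)]gtn_eqF //.
by rewrite /= !mulr0 subrr mulr0.
Qed.

Section Curvature.
Variables (n : int) (A : form1 R) (p0 p1 p2 : R -> R).
Hypothesis p0_diff : forall r : R, 1 < r -> derivable p0 r 1.
Hypothesis p1_diff : forall r : R, 1 < r -> derivable p1 r 1.
Hypothesis p2_diff : forall r : R, 1 < r -> derivable p2 r 1.
Hypothesis A_eq : forall x u : ambient R, A x u = canonical_connection n x u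
       + (p0 x.1 * kappa x u + p1 x.1 * nu1 x u + p2 x.1 * nu2 x u).

(** Along a line of the ambient space every term of [A] has this shape: a function of the radius
    times an affine function of t. *)
Lemma is_derive_affine_mul (p : R -> R) (r a k l : R) : derivable p r 1 ->
  is_derive (0 : R) (1 : R) (fun t : R => p (r + t * a) * (k + t * l))
    (derive1 p r * a * k + p r * l).
Proof.
move=> pr.
have dl (c d : R) : is_derive (0 : R) (1 : R) (fun t : R => c + t * d) d.
  apply: (is_derive_eq (is_deriveD (is_derive_cst c (0 : R) (1 : R))
    (is_deriveM (is_derive_id (0 : R) (1 : R)) (is_derive_cst d (0 : R) (1 : R))))).
  by rewrite /cst /= scaler0 add0r add0r [_ *: _]mulr1.
have dp : is_derive (0 : R) (1 : R) (p \o (fun t => r + t * a)) (derive1 p r * a).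
  apply: is_derive1_comp; rewrite mul0r addr0 derive1E; exact/derivableP.
apply: (is_derive_eq (is_deriveM dp (dl k l))) => /=.
by rewrite !mul0r !addr0 [_ *: l]mulrC [k *: _]mulrC; ring.
Qed.

Lemma dform_connection x u v : 1 < x.1 ->
  let r := x.1 in
  dform A x u v = n%:~R * (zeta u v - zeta v u)
   + (derive1 p0 r * (u.1 * kappa x v - v.1 * kappa x u) + p0 r * (kappa u v - kappa v u))
   + (derive1 p1 r * (u.1 * nu1 x v - v.1 * nu1 x u) + p1 r * (nu1 u v - nu1 v u))
   + (derive1 p2 r * (u.1 * nu2 x v - v.1 * nu2 x u) + p2 r * (nu2 u v - nu2 v u)).
Proof.
move=> r1 r.
have D a b : derive1 (fun t : R => A (translate x t a) b) 0 =
  n%:~R * zeta a b + (derive1 p0 r * a.1 * kappa x b + p0 r * kappa a b)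
  + (derive1 p1 r * a.1 * nu1 x b + p1 r * nu1 a b)
  + (derive1 p2 r * a.1 * nu2 x b + p2 r * nu2 a b).
  have -> : (fun t : R => A (translate x t a) b) =
    (fun t => (fun _ => n%:~R) (r + t * a.1) * (zeta x b + t * zeta a b))
    + (fun t => p0 (r + t * a.1) * (kappa x b + t * kappa a b))
    + (fun t => p1 (r + t * a.1) * (nu1 x b + t * nu1 a b))
    + (fun t => p2 (r + t * a.1) * (nu2 x b + t * nu2 a b)).
    apply/funext => t; rewrite A_eq /canonical_connection.
    by have [-> -> -> ->] := forms_translate x a b t; rewrite /= !addrA.
  (* The coefficient n is taken as a constant function of the radius, so that zeta obeys the same
     rule. *)
  have Dz := @is_derive_affine_mul (fun _ => n%:~R) r a.1 (zeta x b) (zeta a b)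
    (derivable_cst _ _ _).
  have D0 := is_derive_affine_mul a.1 (kappa x b) (kappa a b) (p0_diff r1).
  have D1 := is_derive_affine_mul a.1 (nu1 x b) (nu1 a b) (p1_diff r1).
  have D2 := is_derive_affine_mul a.1 (nu2 x b) (nu2 a b) (p2_diff r1).
  have DA := is_deriveD (is_deriveD (is_deriveD Dz D0) D1) D2.
  rewrite derive1E (@derive_val _ _ _ _ _ _ _ DA).
  by rewrite derive1_cst !mul0r add0r.
rewrite /dform !D; move: (derive1 p0 r) (derive1 p1 r) (derive1 p2 r) (p0 r) (p1 r) (p2 r).
move: (zeta u v) (zeta v u) (kappa u v) (kappa v u) (nu1 u v) (nu1 v u) (nu2 u v) (nu2 v u).
move: (kappa x v) (kappa x u) (nu1 x v) (nu1 x u) (nu2 x v) (nu2 x u) => *; ring.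
Qed.

(** The coefficients of dA in the left-invariant forms, divided by the lengths of two coframe
    elements. With g = dt/dr the products of lengths are g f = r, g c = r^3 / s, c f = s, a b = s /
    2, together with a^2, b^2 and c^2. *)
Definition curvature (r : R) : ext R :=
  let s := Num.sqrt (r ^+ 4 - 1) in
  block_form (derive1 p0 r / r) (- (2 * (n%:~R + p0 r) / (r ^+ 2 - 1)))
         (2 * (p0 r - n%:~R) / (r ^+ 2 + 1)) (- (2 * p0 r / r ^+ 2))
         (derive1 p1 r * s / r ^+ 3) (2 * p1 r / s) (2 * p1 r / s) (- (2 * p1 r / s))
         (derive1 p2 r * s / r ^+ 3) (- (2 * p2 r / s)) (2 * p2 r / s) (2 * p2 r / s).

Lemma pullback2_curvature x : inM x -> pullback2 x (curvature x.1) (dform A x).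
Proof.
move=> xM; split => [S|u v ut vt]; first exact: block_form_support.
rewrite (@pullback_interpR R _ (fun i j => coframe i x u * coframe j x v
  - coframe j x u * coframe i x v)); last by vm_compute.
rewrite !big_cons big_nil; have [r1 _] := xM.
rewrite (dform_connection u v r1).
have [-> -> -> ->] := maurer_cartan xM ut vt.
rewrite /coframe; set r := x.1 in r1 *.
set a := Num.sqrt ((r ^+ 2 - 1) / 2); set b := Num.sqrt ((r ^+ 2 + 1) / 2).
set g := Num.sqrt (r ^+ 4 / (r ^+ 4 - 1)); set s := Num.sqrt (r ^+ 4 - 1).
rewrite /= -/r -/s.
have r4 := exprn4_subr1_gt0 r1; have r0 : 0 < r by lra.
have r2 : 0 < r ^+ 2 - 1 by rewrite subr_gt0 exprn_egt1.
have r2' : 0 < r ^+ 2 + 1 by rewrite addr_gt0 // exprn_gt0.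
have s0 : s != 0 by rewrite gt_eqF // sqrtr_gt0.
have ss : s * s = r ^+ 4 - 1 by rewrite -expr2 sqr_sqrtr // ltW.
have aa : a * a = (r ^+ 2 - 1) / 2 by rewrite -expr2 sqr_sqrtr // ltW // divr_gt0.
have bb : b * b = (r ^+ 2 + 1) / 2 by rewrite -expr2 sqr_sqrtr // ltW // divr_gt0.
have ab : a * b = s / 2.
  rewrite -sqrtrM; last by rewrite ltW // divr_gt0.
  have -> : (r ^+ 2 - 1) / 2 * ((r ^+ 2 + 1) / 2) = (r ^+ 4 - 1) * (2^-1) ^+ 2 by field.
  by rewrite sqrtrM ?(ltW r4) // sqrtr_sqr ger0_norm // invr_ge0.
have gE : g = r ^+ 2 / s.
  have r4E : r ^+ 4 = (r ^+ 2) ^+ 2 by rewrite -exprM.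
  have rr0 : 0 <= r ^+ 2 by rewrite exprn_ge0 // ltW.
  rewrite /g sqrtrM; last by rewrite r4E exprn_ge0.
  rewrite sqrtrV; last exact: ltW.
  by rewrite r4E sqrtr_sqr (ger0_norm rr0) /s r4E.
(* [p] and [q] are the lengths of two coframe elements. Absorbing them into [K] removes every square
   root and leaves a polynomial identity between the values of the forms. *)
have term (w p q K y z y' z' : R) : w * (p * q) = K ->
  w * (p * y * (q * z) - q * z' * (p * y')) = K * (y * z - y' * z').
  by move=> <-; ring.
have rn0 : r != 0 by rewrite gt_eqF.
have r2n0 : r ^+ 2 - 1 != 0 by rewrite gt_eqF.
have r2n0' : r ^+ 2 + 1 != 0 by rewrite gt_eqF.
set f := r^-1 * s.
have gf : g * f = r by rewrite gE /f; field; rewrite rn0 s0.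
have gr : g * r = r ^+ 3 / s by rewrite gE; field.
have rf : r * f = s by rewrite /f; field.
move: (derive1 p0 r) (derive1 p1 r) (derive1 p2 r) (p0 r) (p1 r) (p2 r) => d0 d1 d2 q0 q1 q2.
rewrite (@term (d0 / r) g f d0); last by rewrite gf divfK.
rewrite (@term (- (2 * (n%:~R + q0) / (r ^+ 2 - 1))) a a (- (n%:~R + q0))); last first.
  by rewrite aa; field.
rewrite (@term (2 * (q0 - n%:~R) / (r ^+ 2 + 1)) b b (q0 - n%:~R)); last by rewrite bb; field.
rewrite (@term (- (2 * q0 / r ^+ 2)) r r (- (2 * q0))); last by field.
rewrite (@term (d1 * s / r ^+ 3) g r d1); last by rewrite gr; field; rewrite rn0 s0.
rewrite !(@term (2 * q1 / s) a b q1); try by rewrite ab; field.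
rewrite (@term (- (2 * q1 / s)) r f (- (2 * q1))); last by rewrite rf; field.
rewrite (@term (d2 * s / r ^+ 3) g r d2); last by rewrite gr; field; rewrite rn0 s0.
rewrite (@term (- (2 * q2 / s)) a b (- q2)); last by rewrite ab; field.
rewrite (@term (2 * q2 / s) a b q2); last by rewrite ab; field.
rewrite (@term (2 * q2 / s) r f (2 * q2)); last by rewrite rf; field.
move: (kappa x u) (nu1 x u) (nu2 x u) (sigma1 x u) (sigma2 x u) (mu1 x u) (mu2 x u).
move: (kappa x v) (nu1 x v) (nu2 x v) (sigma1 x v) (sigma2 x v) (mu1 x v) (mu2 x v).
move=> *; ring.
Qed.

Lemma inM_id (r : R) : 1 < r -> inM ((r, 1%:M) : ambient R).
Proof.
move=> r1; split=> //; split; last by rewrite det1.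
by apply/unitarymxP; rewrite mul1mx trmx1 map_mx1.
Qed.

(** [curvature] depends on the radius only, so the points with h = 1 already give all the
    equations. *)
Lemma spin7_instantonE (Phi : ext R) : spin7_instanton Phi A <->
  (forall r, 1 < r -> hodge (curvature r) = - wedge Phi (curvature r)).
Proof.
split=> [H r r1|H x xM].
  have xM := inM_id r1; have [w wF wPhi] := H _ xM.
  by rewrite -(pullback2_unique xM wF (pullback2_curvature xM)).
by exists (curvature x.1); [exact: pullback2_curvature|apply: H; case: xM].
Qed.

End Curvature.

End Connection.

(** * The differential equations *)

Section ODE.
Import numFieldNormedType.Exports.
Variable R : realType.

Lemma is_derive_0_constant (f : R -> R) : (forall r : R, 1 < r -> is_derive r 1 f 0) ->
  forall r, 1 < r -> f r = f 2.
Proof.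
move=> df.
have H a b : 1 < a -> a < b -> f b = f a.
  move=> a1 ab.
  have d01 x : x \in `]a, b[ -> is_derive x 1 f 0.
    by rewrite in_itv /= => /andP[ax _]; apply: df; exact: lt_trans ax.
  have [|c _ /eqP] := MVT ab d01.
    apply: derivable_within_continuous => x; rewrite in_itv /= => /andP[ax _].
    by have [] := df x (lt_le_trans a1 ax).
  by rewrite mul0r subr_eq0 => /eqP.
move=> r r1; have [r2|r2|->//] := ltgtP r 2; last by apply: H => //; lra.
by rewrite -(H r 2).
Qed.

Lemma is_derive_quartic_powR (a r : R) : 1 < r ->
  is_derive r 1 (fun t => (t ^+ 4 - 1) `^ a)
    (a * (4 * r ^+ 3) * ((r ^+ 4 - 1) `^ a / (r ^+ 4 - 1))).
Proof.
move=> r1; have r4 := exprn4_subr1_gt0 r1.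
have d4 : is_derive r 1 (fun t : R => t ^+ 4 - 1) (4 * r ^+ 3).
  have -> : (fun t : R => t ^+ 4 - 1) = (id : R -> R) ^+ 4 - cst 1.
    by rewrite exprfctE.
  have dX := is_deriveX 4 (is_derive_id (r : R) (1 : R)).
  have d1 := is_derive_cst (1 : R) (r : R) (1 : R).
  have dB := is_deriveB dX d1.

  apply: (is_derive_eq dB).
  by rewrite subr0 /GRing.scale /= mulr1.
have dpow := is_derive1_powR a r4.
have dcomp := @is_derive1_comp R (fun t : R => t `^ a) (fun t : R => t ^+ 4 - 1) r
  _ _ dpow d4.
apply: (is_derive_eq dcomp).
rewrite powRB ?powRr1 ?(ltW r4) ?(gt_eqF r4) ?implybT //.
by ring.
Qed.

Lemma linear_ode_quartic (y dy : R -> R) (a : R) :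
  (forall r : R, 1 < r -> is_derive r 1 y (dy r)) ->
  (forall r : R, 1 < r -> (r ^+ 4 - 1) * dy r = a * (4 * r ^+ 3) * y r) <->
  (exists C, forall r, 1 < r -> y r = C * (r ^+ 4 - 1) `^ a).
Proof.
move=> ydy; split=> [ode|[C yE] r r1].
  (* Integrating factor: the equation says exactly that this quotient has derivative zero. *)
  pose f r := y r * (r ^+ 4 - 1) `^ (- a).
  have df (r : R) : 1 < r -> is_derive r 1 f 0.
    move=> r1; have r4 := exprn4_subr1_gt0 r1.
    have dM := is_deriveM (ydy r r1) (is_derive_quartic_powR (- a) r1); apply: (is_derive_eq dM).
    have dyE : dy r = a * (4 * r ^+ 3) * y r / (r ^+ 4 - 1).
      by rewrite -ode // mulrC mulKf // gt_eqF.
    by rewrite dyE /GRing.scale /=; ring.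
  exists (f 2) => r r1; rewrite -(is_derive_0_constant df r1) /f -mulrA -powRD.
    by rewrite addNr powRr0 mulr1.
  by rewrite (gt_eqF (exprn4_subr1_gt0 r1)) implybT.
have r4 := exprn4_subr1_gt0 r1.
have dM := is_deriveM (is_derive_cst C (r : R) (1 : R)) (is_derive_quartic_powR a r1).
(* The closed form of [y] is only known on (1, oo), so its derivative is transferred through
   equality near [r]. *)
have eq_near : \forall t \near r, (cst C * (fun t : R => (t ^+ 4 - 1) `^ a)) t = y t.
  by near=> t; rewrite yE //; near: t; exact: lt_nbhsr.
have [_ dE] := near_eq_is_derive eq_near dM; have [_ <-] := ydy r r1.
rewrite dE.
rewrite yE // /cst /= scaler0 addr0 /GRing.scale /=.
by field; rewrite gt_eqF.
Unshelve. all: by end_near. Qed.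

End ODE.

(** * From the block equations to linear equations in r *)

Section Components.
Variable R : realType.

Lemma divf_eq0_iff (N D : R) : D != 0 -> N / D = 0 <-> N = 0.
Proof.
move=> D0; split=> [/eqP|->]; last by rewrite mul0r.
by rewrite mulf_eq0 invr_eq0 (negPf D0) orbF => /eqP.
Qed.

(* k = 3 or k = -1, according to the component and to L. *)
Lemma nu_component_ode (r q d k : R) : 1 < r ->
  let s := Num.sqrt (r ^+ 4 - 1) in
  d * s / r ^+ 3 + k * (2 * q / s) = 0 <->
  (r ^+ 4 - 1) * d = - (k / 2) * (4 * r ^+ 3) * q.
Proof.
move=> r1 s; have r4 := exprn4_subr1_gt0 r1; have r0 : r != 0 by rewrite gt_eqF //; lra.
have s0 : s != 0 by rewrite gt_eqF // sqrtr_gt0.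
have ss : r ^+ 4 - 1 = s * s by rewrite -expr2 sqr_sqrtr // ltW.
have -> : d * s / r ^+ 3 + k * (2 * q / s) =
    ((r ^+ 4 - 1) * d - - (k / 2) * (4 * r ^+ 3) * q) / (r ^+ 3 * s).
  by rewrite ss; field; rewrite r0 s0.
rewrite divf_eq0_iff ?mulf_neq0 ?expf_neq0 //.
by split=> [/eqP|->]; rewrite ?subrr // subr_eq0 => /eqP.
Qed.

(* e = 1 for L = I and L = K, and e = -1 for L = J. *)
Lemma kappa_component_ode (r q d n e : R) : 1 < r ->
  d / r - e * - (2 * (n + q) / (r ^+ 2 - 1)) + e * (2 * (q - n) / (r ^+ 2 + 1))
    - - (2 * q / r ^+ 2) = 0 <->
  (r ^+ 4 - 1) * (2 * r * q + r ^+ 2 * d) = - e * (4 * r ^+ 3) * (r ^+ 2 * q + n).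
Proof.
move=> r1; have r4 := exprn4_subr1_gt0 r1; have r0 : r != 0 by rewrite gt_eqF //; lra.
have r2 : r ^+ 2 - 1 != 0 by rewrite gt_eqF // subr_gt0 exprn_egt1.
have r2' : r ^+ 2 + 1 != 0 by rewrite gt_eqF // addr_gt0 // exprn_gt0 //; lra.
(* The e^12 and e^34 terms add up to 4 e (r^2 q + n) / (r^4 - 1), and the e^07 and e^56 terms to (2
   r q + r^2 d) / r^3; this is where y = r^2 q + n and its derivative appear. *)
have -> : d / r - e * - (2 * (n + q) / (r ^+ 2 - 1)) + e * (2 * (q - n) / (r ^+ 2 + 1))
    - - (2 * q / r ^+ 2) =
    ((r ^+ 4 - 1) * (2 * r * q + r ^+ 2 * d) - - e * (4 * r ^+ 3) * (r ^+ 2 * q + n))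
      / (r ^+ 3 * ((r ^+ 2 - 1) * (r ^+ 2 + 1))).
  by field; rewrite r0 r2 r2'.
rewrite divf_eq0_iff ?mulf_neq0 ?expf_neq0 //.
by split=> [/eqP|->]; rewrite ?subrr // subr_eq0 => /eqP.
Qed.

Section ODESystem.
Variables (n : int) (p0 p1 p2 : R -> R).
Hypothesis p0_diff : forall r : R, 1 < r -> derivable p0 r 1.
Hypothesis p1_diff : forall r : R, 1 < r -> derivable p1 r 1.
Hypothesis p2_diff : forall r : R, 1 < r -> derivable p2 r 1.

(** The first equation is that of y = r^2 p0 + n, its derivative expanded by the product rule, so
    the system is three uncoupled instances of [linear_ode_quartic]. *)
Lemma ode_system (a0 a1 a2 : R) :
  (forall r : R, 1 < r ->
    [/\ (r ^+ 4 - 1) * (2 * r * p0 r + r ^+ 2 * derive1 p0 r) =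
          a0 * (4 * r ^+ 3) * (r ^+ 2 * p0 r + n%:~R),
        (r ^+ 4 - 1) * derive1 p1 r = a1 * (4 * r ^+ 3) * p1 r
      & (r ^+ 4 - 1) * derive1 p2 r = a2 * (4 * r ^+ 3) * p2 r]) <->
  (exists C0 C1 C2 : R, forall r : R, 1 < r ->
    [/\ r ^+ 2 * p0 r + n%:~R = C0 * (r ^+ 4 - 1) `^ a0,
        p1 r = C1 * (r ^+ 4 - 1) `^ a1 & p2 r = C2 * (r ^+ 4 - 1) `^ a2]).
Proof.
have dp (p : R -> R) : (forall r : R, 1 < r -> derivable p r 1) ->
    forall r : R, 1 < r -> is_derive r 1 p (derive1 p r).
  by move=> pd r /pd pr; rewrite derive1E; exact/derivableP.
have dy (r : R) : 1 < r ->
    is_derive r 1 (fun t => t ^+ 2 * p0 t + n%:~R) (2 * r * p0 r + r ^+ 2 * derive1 p0 r).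
  move=> r1.
  have -> : (fun t : R => t ^+ 2 * p0 t + n%:~R) = (id : R -> R) ^+ 2 * p0 + cst n%:~R.
    by rewrite exprfctE.
  have dX := is_deriveX 2 (is_derive_id (r : R) (1 : R)).
  have dD := is_deriveD (is_deriveM dX (dp _ p0_diff r r1))
    (is_derive_cst (n%:~R : R) (r : R) (1 : R)).
  apply: (is_derive_eq dD); rewrite addr0 exprfctE /GRing.scale /= expr1; ring.
split=> [H|[C0 [C1 [C2 H]]] r r1].
  have [C0 H0] := (linear_ode_quartic a0 dy).1 (fun r r1 => let: And3 h _ _ := H r r1 in h).
  have [C1 H1] := (linear_ode_quartic a1 (dp _ p1_diff)).1
    (fun r r1 => let: And3 _ h _ := H r r1 in h).
  have [C2 H2] := (linear_ode_quartic a2 (dp _ p2_diff)).1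
    (fun r r1 => let: And3 _ _ h := H r r1 in h).
  by exists C0, C1, C2 => r r1; split; [exact: H0|exact: H1|exact: H2].
split.
- by apply: (linear_ode_quartic a0 dy).2 r r1; exists C0 => r r1; have [] := H r r1.
- by apply: (linear_ode_quartic a1 (dp _ p1_diff)).2 r r1; exists C1 => r r1; have [] := H r r1.
- by apply: (linear_ode_quartic a2 (dp _ p2_diff)).2 r r1; exists C2 => r r1; have [] := H r r1.
Qed.

End ODESystem.
End Components.

(* For n = 0 the family - n / r^2 (1 + C0 / (r^4 - 1)) of parts (a) and (c)
   collapses to 0, while the instanton equation still has the one-parameter
   family of solutions C0 / (r^2 (r^4 - 1)); hence the case distinction. *)
Theorem theorem5p3 (R : realType) (n : int) (A : form1 R) (p0 p1 p2 : R -> R)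
    (A_conn : connection_on_E n A)
    (A_inv : SU3_invariant A)
    (A_temp : temporal_gauge A)
    (p0_diff : forall r : R, 1 < r -> derivable p0 r 1)
    (p1_diff : forall r : R, 1 < r -> derivable p1 r 1)
    (p2_diff : forall r : R, 1 < r -> derivable p2 r 1)
    (A_eq : forall x u : ambient R, A x u = canonical_connection n x u
       + (p0 x.1 * kappa x u + p1 x.1 * nu1 x u + p2 x.1 * nu2 x u)) :
  [/\ (* (a) *)
      spin7_instanton (Phi_I R) A <->
      (exists C0 C1 C2 : R, forall r : R, 1 < r ->
        [/\ p0 r = if n == 0 then C0 / (r ^+ 2 * (r ^+ 4 - 1))
                   else - (n%:~R / r ^+ 2) * (1 + C0 / (r ^+ 4 - 1)),
            p1 r = C1 * (r ^+ 4 - 1) `^ (1 / 2)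
          & p2 r = C2 * (r ^+ 4 - 1) `^ (- (3 / 2))]),
      (* (b) *)
      spin7_instanton (Phi_J R) A <->
      (exists C0 C1 C2 : R, forall r : R, 1 < r ->
        [/\ p0 r = - (n%:~R / r ^+ 2) + C0 * ((1 - r ^+ 4) / r ^+ 2),
            p1 r = C1 * (r ^+ 4 - 1) `^ (- (3 / 2))
          & p2 r = C2 * (r ^+ 4 - 1) `^ (- (3 / 2))])
    & (* (c) *)
      spin7_instanton (Phi_K R) A <->
      (exists C0 C1 C2 : R, forall r : R, 1 < r ->
        [/\ p0 r = if n == 0 then C0 / (r ^+ 2 * (r ^+ 4 - 1))
                   else - (n%:~R / r ^+ 2) * (1 + C0 / (r ^+ 4 - 1)),
            p1 r = C1 * (r ^+ 4 - 1) `^ (- (3 / 2))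
          & p2 r = C2 * (r ^+ 4 - 1) `^ (1 / 2)])].
Proof.
(* [k1] and [k2] add up the three signs with which 2 p_j / s enters its block equation: 3 if all are
   positive, -1 in the block of the negated square. *)
have instantonE (Phi : ext R) (e k1 k2 : R) :
    (forall r : R, 1 < r -> let s := Num.sqrt (r ^+ 4 - 1) in
      hodge (curvature n p0 p1 p2 r) = - wedge Phi (curvature n p0 p1 p2 r) <->
      [/\ derive1 p0 r / r - e * - (2 * (n%:~R + p0 r) / (r ^+ 2 - 1))
            + e * (2 * (p0 r - n%:~R) / (r ^+ 2 + 1)) - - (2 * p0 r / r ^+ 2) = 0,
          derive1 p1 r * s / r ^+ 3 + k1 * (2 * p1 r / s) = 0
        & derive1 p2 r * s / r ^+ 3 + k2 * (2 * p2 r / s) = 0]) ->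
    spin7_instanton Phi A <->
    (exists C0 C1 C2 : R, forall r : R, 1 < r ->
      [/\ r ^+ 2 * p0 r + n%:~R = C0 * (r ^+ 4 - 1) `^ (- e),
          p1 r = C1 * (r ^+ 4 - 1) `^ (- (k1 / 2))
        & p2 r = C2 * (r ^+ 4 - 1) `^ (- (k2 / 2))]).
  move=> PhiE.
  apply: (iff_trans (spin7_instantonE p0_diff p1_diff p2_diff A_eq Phi)).
  apply: (iff_trans _ (ode_system n p0_diff p1_diff p2_diff (- e) (- (k1 / 2)) (- (k2 / 2)))).
  split=> H r r1.
    have [/(kappa_component_ode _ _ _ _ r1) h0 /(nu_component_ode _ _ _ r1) h1
          /(nu_component_ode _ _ _ r1) h2] := (PhiE r r1).1 (H r r1).
    by [].
  apply: (PhiE r r1).2; have [h0 h1 h2] := H r r1.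
  split; [exact/(kappa_component_ode _ _ _ _ r1)
         |exact/(nu_component_ode _ _ _ r1)|exact/(nu_component_ode _ _ _ r1)].
(* The solutions for y and the stated families for p0 differ by a change of the constant C0
   alone. *)
have exP (P Q : R -> R -> R -> R -> Prop) (g g' : R -> R) :
    (forall C0 C1 C2 r, 1 < r -> P C0 C1 C2 r -> Q (g C0) C1 C2 r) ->
    (forall C0 C1 C2 r, 1 < r -> Q C0 C1 C2 r -> P (g' C0) C1 C2 r) ->
    (exists C0 C1 C2, forall r, 1 < r -> P C0 C1 C2 r) <->
    (exists C0 C1 C2, forall r, 1 < r -> Q C0 C1 C2 r).
  move=> PQ QP; split=> -[C0 [C1 [C2 h]]].
    by exists (g C0), C1, C2 => r r1; apply: PQ (h r r1).
  by exists (g' C0), C1, C2 => r r1; apply: QP (h r r1).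
have half : - (-1 / 2) = 1 / 2 :> R by field.
have decayE (C r : R) : 1 < r ->
    r ^+ 2 * p0 r + n%:~R = C * (r ^+ 4 - 1) `^ (- 1) <->
    p0 r = if n == 0 then C / (r ^+ 2 * (r ^+ 4 - 1))
           else - (n%:~R / r ^+ 2) * (1 + (- C / n%:~R) / (r ^+ 4 - 1)).
  move=> r1; have r4 := exprn4_subr1_gt0 r1; have r0 : r != 0 by rewrite gt_eqF //; lra.
  have r4n := lt0r_neq0 r4; rewrite powR_inv1 ?(ltW r4) //.
  have -> : (if n == 0 then C / (r ^+ 2 * (r ^+ 4 - 1))
      else - (n%:~R / r ^+ 2) * (1 + (- C / n%:~R) / (r ^+ 4 - 1)))
      = (C / (r ^+ 4 - 1) - n%:~R) / r ^+ 2.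
    case: eqP => [->|/eqP n0]; first by rewrite subr0; field; rewrite r0 r4n.
    have n0' : n%:~R != 0 :> R by rewrite intr_eq0.
    by field; rewrite r0 r4n n0'.
  split=> [<-|->]; first by field.
  by field; rewrite r0 r4n.
have growE (C r : R) : 1 < r ->
    r ^+ 2 * p0 r + n%:~R = C * (r ^+ 4 - 1) `^ (- - 1) <->
    p0 r = - (n%:~R / r ^+ 2) + - C * ((1 - r ^+ 4) / r ^+ 2).
  move=> r1; have r4 := exprn4_subr1_gt0 r1; have r0 : r != 0 by rewrite gt_eqF //; lra.
  rewrite opprK powRr1 ?(ltW r4) //; split=> [h|->]; last by field.
  apply: (mulfI (expf_neq0 2 r0)); apply: (addIr n%:~R); rewrite h; by field.
have decay_family a1 a2 :
    (exists C0 C1 C2 : R, forall r : R, 1 < r ->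
      [/\ r ^+ 2 * p0 r + n%:~R = C0 * (r ^+ 4 - 1) `^ (- 1),
          p1 r = C1 * (r ^+ 4 - 1) `^ a1 & p2 r = C2 * (r ^+ 4 - 1) `^ a2]) <->
    (exists C0 C1 C2 : R, forall r : R, 1 < r ->
      [/\ p0 r = if n == 0 then C0 / (r ^+ 2 * (r ^+ 4 - 1))
                 else - (n%:~R / r ^+ 2) * (1 + C0 / (r ^+ 4 - 1)),
          p1 r = C1 * (r ^+ 4 - 1) `^ a1 & p2 r = C2 * (r ^+ 4 - 1) `^ a2]).
  (* Solving y = C / (r^4 - 1) gives p0 = (C / (r^4 - 1) - n) / r^2, hence the constant - C / n when
     -n / r^2 can be factored out. *)
  apply: (exP _ _ (fun C => if n == 0 then C else - C / n%:~R)
    (fun C => if n == 0 then C else - C * n%:~R)) => C0 C1 C2 r r1 [h0 h1 h2]; split=> //.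
    by move/(decayE _ _ r1): h0 => ->; case: eqP.
  apply/(decayE _ _ r1); rewrite h0; case: eqP => [//|/eqP n0].
  by rewrite (_ : - (- C0 * n%:~R) / n%:~R = C0) // -mulNr opprK mulfK // intr_eq0.
split.
- rewrite -half; apply: (iff_trans (@instantonE _ 1 (-1) 3 _)); last exact: decay_family.
  move=> r r1 /=; apply: (iff_trans (instanton_block_form_I _ _ _ _ _ _ _ _ _ _ _ _)).
  by split=> -[h0 h1 h2]; split; lra.
- apply: (iff_trans (@instantonE _ (-1) 3 3 _)).
    move=> r r1 /=; apply: (iff_trans (instanton_block_form_J _ _ _ _ _ _ _ _ _ _ _ _)).
    by split=> -[h0 h1 h2]; split; lra.
  (* Here y = C (r^4 - 1), while the stated family is written with 1 - r^4. *)
  apply: (exP _ _ -%R -%R) => C0 C1 C2 r r1 [h0 h1 h2]; split => //.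
    by apply/growE.
  by apply/growE; rewrite ?opprK.
- rewrite -half; apply: (iff_trans (@instantonE _ 1 3 (-1) _)); last exact: decay_family.
  move=> r r1 /=; apply: (iff_trans (instanton_block_form_K _ _ _ _ _ _ _ _ _ _ _ _)).
  by split=> -[h0 h1 h2]; split; lra.
Qed.
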